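(* Let $P$ be the set of $\alpha\in\mathbb{F}_2((1/t))$ with $|\alpha|<1$, and let $D\subseteq P$ be the set of irrational $\alpha\in\mathbb{F}_2((1/t))$ whose continued fraction expansion is $\alpha=[0;a_1,a_2,\ldots]$ with $\deg(a_i)=1$ (i.e. $a_i\in\{t,t+1\}$) for all $i\ge1$. Then an element $\alpha\in P$ belongs to $D$ if and only if $$(\alpha\cdot t(t+1))'=\alpha^2+1,$$ where $'$ denotes formal differentiation with respect to $t$.
   Context: $\mathbb{F}_2((1/t))$ is the field of formal Laurent series in $1/t$ over $\mathbb{F}_2$, with absolute value $|\alpha|=|t|^n$ for $\alpha=t^n+\sum_{i<n}c_it^i$ (fixed real $|t|>1$), $|0|=0$. Every irrational element has an infinite continued fraction expansion $[a_0;a_1,a_2,\ldots]$ with $a_i\in\mathbb{F}_2[t]$, $\deg a_i>0$ for $i>0$. Formal differentiation acts termwise: $(\sum c_i t^i)'=\sum i c_i t^{i-1}$. *)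

(* Defs.v *)
From HB Require Import structures.
From mathcomp Require Import all_boot all_order all_algebra.
From mathcomp Require Import zify.
From mathcomp Require Import boolp classical_sets functions cardinality fsbigop.
From mathcomp Require Import reals topology normedtype sequences.

Set Implicit Arguments.
Unset Strict Implicit.
Unset Printing Implicit Defensive.

Import Order.TTheory GRing.Theory Num.Theory.
Import numFieldNormedType.Exports.

Local Open Scope classical_set_scope.
Local Open Scope ring_scope.

(* [laurent F] is F((1/t)): [lcoef a i] is the coefficient of t^i, so the
   support is bounded above, and exponents tend to -oo. *)
Record laurent (F : fieldType) := Laurent {
  lcoef :> int -> F;
  lcoef_bounded : exists n : int, forall i : int, n < i -> lcoef i = 0 }.

Section LaurentField.
Variable F : fieldType.
Implicit Types a b c : laurent F.

HB.instance Definition _ := gen_eqMixin (laurent F).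
HB.instance Definition _ := gen_choiceMixin (laurent F).

Lemma laurentP a b : (forall i, a i = b i) <-> a = b.
Proof.
split=> [|->//]; case: a b => [a ha] [b hb] /= /funext eab.
by move: ha hb; rewrite eab => ha hb; congr Laurent; exact: Prop_irrelevance.
Qed.

Definition lbound (n : int) (a : int -> F) := forall i : int, n < i -> a i = 0.

Lemma lbound2 a b : exists n, lbound n a /\ lbound n b.
Proof.
have [m hm] := lcoef_bounded a; have [n hn] := lcoef_bounded b.
by exists (Num.max m n); split=> i; rewrite gt_max => /andP[h1 h2];
  [exact: hm | exact: hn].
Qed.

Lemma lexpP (m i : int) : m < i \/ exists k : nat, i = m - k%:Z.
Proof.
have [le_im | lt_mi] := lerP i m; last by left.
by right; exists `|m - i|%N; lia.
Qed.

Fact lzero_subproof : exists n : int, lbound n (fun=> 0).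
Proof. by exists 0. Qed.
Definition lzero := Laurent lzero_subproof.

Fact lopp_subproof a : exists n : int, lbound n (fun i => - a i).
Proof. by case: a => a [n hn]; exists n => i /hn /= ->; rewrite oppr0. Qed.
Definition lopp a := Laurent (lopp_subproof a).

Fact ladd_subproof a b : exists n : int, lbound n (fun i => a i + b i).
Proof.
by have [n [ha hb]] := lbound2 a b; exists n => i hi; rewrite ha ?hb ?addr0.
Qed.
Definition ladd a b := Laurent (ladd_subproof a b).

Fact laddA : associative ladd.
Proof. by move=> a b c; apply/laurentP => i /=; rewrite addrA. Qed.
Fact laddC : commutative ladd.
Proof. by move=> a b; apply/laurentP => i /=; rewrite addrC. Qed.
Fact ladd0 : left_id lzero ladd.
Proof. by move=> a; apply/laurentP => i /=; rewrite add0r. Qed.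
Fact laddN : left_inverse lzero lopp ladd.
Proof. by move=> a; apply/laurentP => i /=; rewrite addNr. Qed.

HB.instance Definition _ :=
  GRing.isZmodule.Build (laurent F) laddA laddC ladd0 laddN.

(* For series with support bounded above only finitely many terms of this sum
   are nonzero, so that the finitely-supported sum is the Cauchy product. *)
Definition lmulc (a b : int -> F) (k : int) : F :=
  \sum_(i \in [set: int]) a i * b (k - i).

Lemma lmulcE (r : seq int) (a b : int -> F) k : uniq r ->
  (forall i, i \notin r -> a i * b (k - i) = 0) ->
  lmulc a b k = \sum_(i <- r) a i * b (k - i).
Proof.
move=> ur hr; rewrite (fsbig_seq _ _ ur); apply/esym/fsbig_widen => //.
by move=> i [_] /= /negP; exact: hr.
Qed.

Lemma lmulc_coef m n (a b : int -> F) (k : nat) : lbound m a -> lbound n b ->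
  lmulc a b (m + n - k%:Z) =
    \sum_(i < k.+1) a (m - i%:Z) * b (n - (k - i)%N%:Z).
Proof.
move=> ha hb; rewrite (@lmulcE [seq m - i%:Z | i <- iota 0 k.+1]).
- rewrite big_map -[iota 0 k.+1]/(index_iota 0 k.+1) big_mkord.
  by apply: eq_bigr => i _; congr (_ * b _); have := ltn_ord i; lia.
- by rewrite map_inj_uniq ?iota_uniq // => i j; lia.
- move=> i; have [/ha->|[j ->] hj] := lexpP m i; first by rewrite mul0r.
  have {hj} : (k < j)%N.
    rewrite ltnNge; apply: contra hj => hj.
    by apply/mapP; exists j => //; rewrite mem_iota.
  by move=> hj; rewrite hb ?mulr0 //; lia.
Qed.

Lemma lmulc_bound m n (a b : int -> F) : lbound m a -> lbound n b ->
  lbound (m + n) (lmulc a b).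
Proof.
move=> ha hb k hk; rewrite (@lmulcE [::]) ?big_nil // => i _.
have [/ha->|hi] := ltrP m i; first by rewrite mul0r.
by rewrite hb ?mulr0 //; lia.
Qed.

Fact lmul_subproof a b : exists n : int, lbound n (lmulc a b).
Proof.
by have [n [ha hb]] := lbound2 a b; exists (n + n); exact: lmulc_bound.
Qed.
Definition lmul a b := Laurent (lmul_subproof a b).

Fact lpoly_subproof (p : {poly F}) :
  exists n : int, lbound n (fun i => if i is Posz k then p`_k else 0).
Proof.
by exists (size p)%:Z; case=> //= k hk; rewrite nth_default //; lia.
Qed.
Definition lpoly (p : {poly F}) := Laurent (lpoly_subproof p).

Definition ltrunc (n : int) (M : nat) (a : int -> F) : {poly F} :=
  \poly_(i < M) a (n - i%:Z).

Lemma lmulc_trunc m n M (a b : int -> F) (k : nat) :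
  lbound m a -> lbound n b -> (k < M)%N ->
  lmulc a b (m + n - k%:Z) = (ltrunc m M a * ltrunc n M b)`_k.
Proof.
move=> ha hb hk; rewrite lmulc_coef // coefM; apply: eq_bigr => i _.
by rewrite !coef_poly !ifT //; have := ltn_ord i; lia.
Qed.

Fact lmulC : commutative lmul.
Proof.
move=> a b; apply/laurentP => i /=; have [n [ha hb]] := lbound2 a b.
have [hi|[k ->]] := lexpP (n + n) i; first by rewrite !(@lmulc_bound n n).
by rewrite !(@lmulc_trunc n n k.+1) // mulrC.
Qed.

Fact lmulA : associative lmul.
Proof.
move=> a b c; apply/laurentP => i /=.
have [[m ha] [n hb] [p hc]] :=
  And3 (lcoef_bounded a) (lcoef_bounded b) (lcoef_bounded c).
have hbc := lmulc_bound hb hc; have hab := lmulc_bound ha hb.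
have [hi|[k ->]] := lexpP (m + n + p) i.
  by rewrite (lmulc_bound hab hc hi) (lmulc_bound ha hbc) // addrA.
rewrite (lmulc_trunc hab hc (ltnSn k)) -[m + n + p]addrA.
rewrite (lmulc_trunc ha hbc (ltnSn k)).
transitivity (ltrunc m k.+1 a * ltrunc n k.+1 b * ltrunc p k.+1 c)`_k.
  rewrite -mulrA [LHS]coefM [RHS]coefM; apply: eq_bigr => j _; congr (_ * _).
  rewrite coef_poly ifT; last by have := ltn_ord j; lia.
  by rewrite (lmulc_trunc (M := k.+1) hb hc) //; have := ltn_ord j; lia.
rewrite [LHS]coefM [RHS]coefM; apply: eq_bigr => j _; congr (_ * _).
by rewrite coef_poly ltn_ord (lmulc_trunc (M := k.+1) ha hb).
Qed.

Fact lmul1 : left_id (lpoly 1) lmul.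
Proof.
move=> a; apply/laurentP => i /=; rewrite (@lmulcE [:: 0]) //.
  by rewrite big_seq1 subr0 /= coef1 mul1r.
by move=> [[|j]|j]; rewrite ?inE //= ?coef1 ?mul0r.
Qed.

Fact lmulDl : left_distributive lmul ladd.
Proof.
move=> a b c; apply/laurentP => i /=.
have [[n [ha hb]] [p hc]] := (lbound2 a b, lcoef_bounded c).
have hab : lbound n (ladd a b) by move=> j hj /=; rewrite ha ?hb ?addr0.
have [hi|[k ->]] := lexpP (n + p) i.
  by rewrite (lmulc_bound hab hc) // !(@lmulc_bound n p) // addr0.
rewrite (lmulc_coef _ hab hc) !(@lmulc_coef n p) // -big_split /=.
by apply: eq_bigr => j _; rewrite mulrDl.
Qed.

Fact lone_neq0 : lpoly 1 != 0.
Proof.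
apply/eqP => /(congr1 (fun a : laurent F => a 0)) /= /eqP.
by rewrite coef1 oner_eq0.
Qed.

HB.instance Definition _ := GRing.Zmodule_isComNzRing.Build (laurent F)
  lmulA lmulC lmul1 lmulDl lone_neq0.

Lemma ldeg_exists a : a != 0 -> exists n : int, a n != 0 /\ lbound n a.
Proof.
move=> a0; have [m hm] := lcoef_bounded a.
have ex : exists k : nat, a (m - k%:Z) != 0.
  apply: contrapT => /forallNP h; case/eqP: a0; apply/laurentP => i /=.
  by have [/hm//|[k ->]] := lexpP m i; apply/eqP/negPn/negP.
have := ex_minnP ex => -[k hk kmin].
exists (m - k%:Z); split=> // i hi.
have [/hm//|[j ej]] := lexpP m i; subst i; apply/eqP/negPn/negP => /kmin.
by lia.
Qed.

Section Inverse.
Variable u : nat -> F.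

Fixpoint linv_seq (n : nat) : seq F :=
  if n is k.+1 then
    rcons (linv_seq k)
      (((k == 0)%:R - \sum_(i < k) u (k - i) * (linv_seq k)`_i) / u 0)
  else [::].

Lemma size_linv_seq n : size (linv_seq n) = n.
Proof. by elim: n => //= n IH; rewrite size_rcons IH. Qed.

Lemma nth_linv_seq n k : (k < n)%N -> (linv_seq n)`_k = (linv_seq k.+1)`_k.
Proof.
elim: n => // n IH; rewrite ltnS leq_eqVlt => /orP[/eqP->//|hk].
by rewrite [linv_seq n.+1]/= nth_rcons size_linv_seq hk IH.
Qed.

Lemma linv_seqP k : u 0 != 0 ->
  \sum_(i < k.+1) u (k - i)%N * (linv_seq i.+1)`_i = (k == 0)%:R.
Proof.
move=> u0; rewrite big_ord_recr /= nth_rcons size_linv_seq ltnn eqxx subnn.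
rewrite [u 0 * _]mulrC divfK // addrC -[RHS]addr0 -addrA; congr (_ + _).
apply/eqP; rewrite addrC subr_eq0; apply/eqP/eq_bigr => i _.
by rewrite [in RHS]nth_linv_seq.
Qed.

End Inverse.

Lemma linv_exists a : a != 0 -> exists b, a * b = 1.
Proof.
move=> /ldeg_exists[n [an0 ha]].
pose u k := a (n - k%:Z).
pose v (i : int) : F :=
  if i <= - n then (linv_seq u (absz (- n - i)).+1)`_(absz (- n - i)) else 0.
have hv : lbound (- n) v by move=> i hi; rewrite /v leNgt hi.
exists (@Laurent F v (ex_intro _ (- n) hv)); apply/laurentP => i.
change (lmulc a v i = lpoly 1 i).
have [hi|[k ->]] := lexpP (n + - n) i.
  rewrite (lmulc_bound ha hv) //=; case: i hi => // i hi.
  by rewrite coef1; case: eqP hi => [->|//]; rewrite subrr ltxx.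
have -> : lpoly 1 (n - n - k%:Z) = (k == 0)%:R.
  rewrite subrr sub0r; case: k => [|k] /=; first by rewrite coef1.
  by [].
rewrite (lmulc_coef _ ha hv) -(@linv_seqP u); last by rewrite /u subr0.
rewrite (reindex_inj rev_ord_inj) /=; apply: eq_bigr => j _.
have hj := ltn_ord j; rewrite /u /v ifT; last by lia.
by congr (a _ * (linv_seq u _.+1)`_ _); lia.
Qed.

(* The chosen inverse is the unique b with a * b = 1, and 0 when a = 0. *)
Definition linv a : laurent F := xget 0 [set b | a * b = 1].

Fact lmulVf a : a != 0 -> linv a * a = 1.
Proof.
move=> /linv_exists[b hb]; rewrite mulrC.
exact: (@xgetPex _ 0 [set b | a * b = 1] (ex_intro _ b hb)).
Qed.

Fact linv0 : linv 0 = 0.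
Proof.
apply: xgetPN => b /= /eqP.
by rewrite mul0r eq_sym oner_eq0.
Qed.

HB.instance Definition _ :=
  GRing.ComNzRing_isField.Build (laurent F) lmulVf linv0.

Fact lpoly_zmod_morphism : zmod_morphism lpoly.
Proof.
by move=> p q; apply/laurentP => -[i|i] /=; rewrite ?coefB ?subr0.
Qed.

Fact lpoly_monoid_morphism : monoid_morphism lpoly.
Proof.
split=> // p q; apply/laurentP => -[i|i] /=.
  rewrite (@lmulcE [seq j%:Z | j <- iota 0 i.+1]).
  - rewrite big_map -[iota 0 i.+1]/(index_iota 0 i.+1) big_mkord coefM.
    apply: eq_bigr => j _; have hj := ltn_ord j.
    by have -> : Posz i - Posz j = Posz (i - j)%N by lia.
  - by rewrite map_inj_uniq ?iota_uniq // => j k [].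
  - move=> [j|j] hj /=; last by rewrite mul0r.
    have {}hj : (i < j)%N.
      rewrite ltnNge; apply: contra hj => hj.
      by apply/mapP; exists j => //; rewrite mem_iota.
    by case E: (Posz i - Posz j) => [k|k]; [lia | rewrite mulr0].
rewrite (@lmulcE [::]) ?big_nil // => -[j|j] _ /=; last by rewrite mul0r.
by case E: (Negz i - Posz j) => [k|k]; [lia | rewrite mulr0].
Qed.

HB.instance Definition _ :=
  GRing.isZmodMorphism.Build {poly F} (laurent F) lpoly lpoly_zmod_morphism.
HB.instance Definition _ :=
  GRing.isMonoidMorphism.Build {poly F} (laurent F) lpoly lpoly_monoid_morphism.

(* (sum_i c_i t^i)' = sum_i i c_i t^(i-1): the coefficient of t^i is
   (i + 1) c_(i+1). *)
Fact lderiv_subproof a : exists n : int, lbound n (fun i => a (i + 1) *~ (i + 1)).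
Proof.
by have [n hn] := lcoef_bounded a; exists n => i hi; rewrite hn ?mul0rz //; lia.
Qed.
Definition lderiv a : laurent F := Laurent (lderiv_subproof a).

Definition ldeg a : int :=
  xget 0 [set n : int | a n != 0 /\ forall i : int, n < i -> a i = 0].

Lemma ldegP a : a != 0 ->
  a (ldeg a) != 0 /\ (forall i : int, ldeg a < i -> a i = 0).
Proof.
move=> /ldeg_exists[n hn].
exact: (@xgetPex _ 0 [set n : int | a n != 0 /\ forall i : int, n < i -> a i = 0]
  (ex_intro _ n hn)).
Qed.

(* [T] is the real number |t|. *)
Definition labs (R : realType) (T : R) a : R :=
  if a == 0 then 0 else T ^ ldeg a.

Definition rational a :=
  exists p q : {poly F}, q != 0 /\ a = lpoly p / lpoly q.

(* [cfrac x [:: y1; ..; yn]] is x + 1/(y1 + 1/(.. + 1/yn)). *)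
Fixpoint cfrac (x : laurent F) (s : seq (laurent F)) : laurent F :=
  if s is y :: s' then x + (cfrac y s')^-1 else x.

Definition convergent (p : nat -> {poly F}) (n : nat) : laurent F :=
  cfrac (lpoly (p 0%N)) [seq lpoly (p i) | i <- iota 1 n].

(* a = [p 0; p 1, p 2, ...], an infinite expansion whose convergents tend to a
   for the absolute value. *)
Definition cf_expansion (R : realType) (T : R) a (p : nat -> {poly F}) :=
  (forall i : nat, (0 < i)%N -> (1 < size (p i))%N) /\
  labs T (a - convergent p n) @[n --> \oo] --> (0 : R).

End LaurentField.

Arguments lpoly {F} p.

Definition lvar (F : fieldType) : laurent F := lpoly 'X.

Definition Pset (R : realType) (T : R) : set (laurent 'F_2) :=
  [set a | labs T a < 1].

Definition Dset (R : realType) (T : R) : set (laurent 'F_2) :=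
  [set a | ~ rational a /\
     exists p : nat -> {poly 'F_2},
       [/\ cf_expansion T a p, p 0%N = 0
         & forall i : nat, (1 <= i)%N -> size (p i) = 2%N]].

(* Main.v *)
(* Write [ric a := a' (t^2 + t) + a + a^2 + 1]; as [(t^2 + t)' = 1] in
   characteristic 2, the differential equation says [ric a = 0].  This Riccati
   expression satisfies [ric (1/a) = ric a / a^2] and [ric (p + b) = ric b] when
   [p] is [t] or [t + 1], so it is preserved, up to the square of the complete
   quotient, by one step of a continued fraction with linear partial quotients.
   For the convergents it starts from [ric 0 = 1] and tends to 0, hence it
   vanishes on [D].  Conversely, a degree count shows that the reciprocal of a
   solution in [P] has degree 1, so its polynomial part is [t] or [t + 1] and the
   fractional part is again a solution in [P]; iterating yields the expansion. *)
Require Import Defs.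
From mathcomp Require Import all_boot all_order all_algebra.
From mathcomp Require Import zify ring.
From mathcomp Require Import boolp classical_sets reals.
From mathcomp Require Import topology normedtype sequences.

Import Order.TTheory GRing.Theory Num.Theory.
Import numFieldNormedType.Exports.
(* Again, since classical_sets has its own [lbound]. *)
Import Defs.

Set Implicit Arguments.
Unset Strict Implicit.
Unset Printing Implicit Defensive.

Local Open Scope classical_set_scope.
Local Open Scope ring_scope.

(** * Field identities *)

Section FieldIdentities.
Variable K : fieldType.
Implicit Types c d q x y : K.

(** With [d] the derivative of [x], [d / x ^+ 2] is the derivative of [x^-1] up to a sign, which is
    invisible in characteristic 2. *)
Lemma riccati_inversion d q x : x != 0 ->
  d / x ^+ 2 * q + x^-1 + x ^- 2 + 1 = (d * q + x + x ^+ 2 + 1) / x ^+ 2.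
Proof. by move=> x0; field. Qed.

Lemma subV_eq x y : x != 0 -> y != 0 -> x^-1 - y^-1 = - (x - y) * (x^-1 * y^-1).
Proof. by move=> x0 y0; field; rewrite x0 y0. Qed.

Lemma div_sub_eq c x y : x != 0 -> y / x - c = (y - c * x) / x.
Proof. by move=> x0; field. Qed.

End FieldIdentities.

(** * Degrees and formal differentiation of Laurent series *)

Section LaurentDegree.
Variable F : fieldType.
Implicit Types (a b : laurent F) (m n k : int).

Lemma lboundW m n a : m <= n -> lbound m a -> lbound n a.
Proof. by move=> le_mn ha i hi; apply: ha; lia. Qed.

Lemma lboundD n a b : lbound n a -> lbound n b -> lbound n (a + b).
Proof. by move=> ha hb i hi; rewrite /= ha // hb // addr0. Qed.

Lemma lboundN n a : lbound n a -> lbound n (- a).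
Proof. by move=> ha i hi; rewrite /= ha // oppr0. Qed.

Lemma lboundM m n a b : lbound m a -> lbound n b -> lbound (m + n) (a * b).
Proof. exact: lmulc_bound. Qed.

Lemma lbound_lpoly (p : {poly F}) : lbound ((size p)%:Z - 1) (lpoly p).
Proof. by case=> //= k hk; rewrite nth_default //; lia. Qed.

Lemma lbound_lderiv n a : lbound n a -> lbound (n - 1) (lderiv a).
Proof. by move=> ha i hi /=; rewrite ha ?mul0rz //; lia. Qed.

Lemma lbound_eq0 a : (forall n, lbound n a) -> a = 0.
Proof. by move=> ha; apply/laurentP => i /=; apply: (ha (i - 1)); lia. Qed.

(** Relational form of the degree: it fails for [0], where [ldeg] takes a default value. *)
Definition has_ldeg n a := a n != 0 /\ lbound n a.

Lemma has_ldeg_uniq m n a : has_ldeg m a -> has_ldeg n a -> m = n.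
Proof.
move=> [am ha] [an hb]; apply/eqP; rewrite eq_le; apply/andP; split.
  by rewrite leNgt; apply: contra am => /hb ->.
by rewrite leNgt; apply: contra an => /ha ->.
Qed.

Lemma has_ldeg_neq0 n a : has_ldeg n a -> a != 0.
Proof. by move=> [an _]; apply: contra an => /eqP ->. Qed.

Lemma has_ldegM m n a b : has_ldeg m a -> has_ldeg n b -> has_ldeg (m + n) (a * b).
Proof.
move=> [am ha] [bn hb]; split; last exact: lboundM.
(* The top coefficient of the Cauchy product is a single term. *)
have := lmulc_coef 0 ha hb; rewrite big_ord_recl big_ord0 /= !subr0 addr0 => ->.
by rewrite mulf_neq0.
Qed.

Lemma has_ldeg1 : has_ldeg 0 (1 : laurent F).
Proof.
split; first by rewrite /= coef1 oner_eq0.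
by move=> [[|i]|i] //= _; rewrite coef1.
Qed.

Lemma has_ldegV n a : has_ldeg n a -> has_ldeg (- n) a^-1.
Proof.
move=> da; have a0 := has_ldeg_neq0 da.
have [m dV] : exists m, has_ldeg m a^-1 by apply: ldeg_exists; rewrite invr_eq0.
have := has_ldegM da dV; rewrite mulfV // => /has_ldeg_uniq/(_ has_ldeg1) nm.
by have -> : - n = m by lia.
Qed.

Lemma has_ldegD n a b : has_ldeg n a -> lbound (n - 1) b -> has_ldeg n (a + b).
Proof.
move=> [an ha] hb; split; first by rewrite /= hb ?addr0 //; lia.
by apply: lboundD => //; apply: lboundW hb; lia.
Qed.

Lemma has_ldeg_lpoly (p : {poly F}) (d : nat) :
  size p = d.+1 -> has_ldeg d (lpoly p).
Proof.
move=> sp; split; last by apply: lboundW (@lbound_lpoly p); rewrite sp; lia.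
have : lead_coef p != 0 by rewrite lead_coef_eq0 -size_poly_eq0 sp.
by rewrite lead_coefE sp.
Qed.

Lemma lpoly_eq0 (p : {poly F}) : (lpoly p == 0) = (p == 0).
Proof.
apply/eqP/eqP => [lp0|->]; last exact: rmorph0.
by apply/polyP => i; rewrite coef0 -[p`_i]/(lpoly p (Posz i)) lp0.
Qed.

Lemma lderivM a b : lderiv (a * b) = lderiv a * b + a * lderiv b.
Proof.
apply/laurentP => k.
change (lmulc a b (k + 1) *~ (k + 1) = lmulc (lderiv a) b k + lmulc a (lderiv b) k).
have [[m ha] [n hb]] := (lcoef_bounded a, lcoef_bounded b).
have ha' := lbound_lderiv ha; have hb' := lbound_lderiv hb.
have [hk|[j ->]] := lexpP (m + n - 1) k.
  rewrite (lmulc_bound ha hb) ?(lmulc_bound ha' hb) ?(lmulc_bound ha hb')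
    ?mul0rz ?addr0 //; lia.
have -> : m + n - 1 - j%:Z + 1 = m + n - j%:Z by lia.
rewrite (lmulc_coef _ ha hb).
have -> : m + n - 1 - j%:Z = (m - 1) + n - j%:Z by lia.
rewrite (lmulc_coef _ ha' hb).
have -> : m - 1 + n - j%:Z = m + (n - 1) - j%:Z by lia.
rewrite (lmulc_coef _ ha hb') -big_split mulrz_suml /=; apply: eq_bigr => i _.
have hi := ltn_ord i.
have -> : m - 1 - i%:Z + 1 = m - i%:Z by lia.
have -> : n - 1 - (j - i)%N%:Z + 1 = n - (j - i)%N%:Z by lia.
(* In each term the exponents of the two factors add up to the exponent of the product, which gives
   the Leibniz rule termwise. *)
rewrite mulrzAl mulrzAr -mulrzDr; congr (_ *~ _); lia.
Qed.

Lemma lderivD a b : lderiv (a + b) = lderiv a + lderiv b.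
Proof. by apply/laurentP => k /=; rewrite mulrzDl. Qed.

Lemma lderiv0 : lderiv (0 : laurent F) = 0.
Proof. by apply/laurentP => k /=; rewrite mul0rz. Qed.

Lemma lderiv_lpoly (p : {poly F}) : lderiv (lpoly p) = lpoly p^`().
Proof.
apply/laurentP => -[k|k] /=.
  by rewrite coef_deriv -[k.+1]addn1.
case: k => [|k].
  by have -> : Negz 0 + 1 = 0 by []; rewrite mulr0z.
have -> : Negz k.+1 + 1 = Negz k by lia.
by rewrite mul0rz.
Qed.

Lemma lderivV a : a != 0 -> lderiv a^-1 = - lderiv a / a ^+ 2.
Proof.
move=> a0; have : lderiv (a * a^-1) = 0.
  by rewrite mulfV // -[1 : laurent F]/(lpoly 1) lderiv_lpoly derivC rmorph0.
rewrite lderivM => h; apply: (mulfI a0).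
by rewrite -[LHS]addr0 -oppr0 -h; field.
Qed.

(** * The absolute value in terms of degree bounds *)

Section AbsoluteValue.
Variables (R : realType) (T : R).
Hypothesis T_gt1 : 1 < T.

Lemma labs_le n a : lbound n a -> labs T a <= T ^ n.
Proof.
move=> ha; rewrite /labs; case: ifPn => [_|/ldegP[a0 _]].
  by apply: exprz_ge0; apply: ltW; exact: lt_trans T_gt1.
rewrite ler_weXz2l //; first exact: ltW.
by rewrite leNgt; apply: contra a0 => /ha ->.
Qed.

Lemma labs_lt_lbound n a : labs T a < T ^ (n + 1) -> lbound n a.
Proof.
rewrite /labs; case: ifPn => [/eqP -> _ //|/ldegP[_ ha]].
by rewrite ltr_eXz2l // => hn; apply: lboundW ha; lia.
Qed.

Lemma labs_lt1P a : labs T a < 1 <-> lbound (-1) a.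
Proof.
split=> [h|/labs_le h]; first by apply: labs_lt_lbound; rewrite addNr expr0z.
apply: le_lt_trans h _.
by rewrite -[ltRHS](expr0z T) ltr_eXz2l.
Qed.

(** Turns real convergence into integer degree bounds, which the rest of the proof manipulates. *)
Lemma labs_cvg0P (u : nat -> laurent F) :
  labs T (u n) @[n --> \oo] --> (0 : R) <->
  forall n, \forall k \near \oo, lbound n (u k).
Proof.
have T_gt0 : 0 < T := lt_trans ltr01 T_gt1.
have labs_ge0 a : 0 <= labs T a.
  by rewrite /labs; case: ifP => // _; rewrite exprz_ge0 // ltW.
split=> [/cvgrPdist_lt uc n|ub].
  have := uc (T ^ (n + 1)) (exprz_gt0 _ T_gt0); apply: filterS => k.
  by rewrite sub0r normrN ger0_norm // => /labs_lt_lbound.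
apply/cvgrPdist_lt => e e0.
have /cvgrPdist_lt/(_ e e0)[N _ hN] : (fun j : nat => T^-1 ^+ j) @ \oo --> (0 : R).
  by apply: cvg_expr; rewrite ger0_norm ?invr_ge0 ?(ltW T_gt0) // invf_lt1.
have := ub (- N%:Z); apply: filterS => k /labs_le hk.
rewrite sub0r normrN ger0_norm //; apply: le_lt_trans hk _.
have := hN N (leqnn N); rewrite /= sub0r normrN ger0_norm; last first.
  by rewrite exprn_ge0 // invr_ge0 ltW.
by rewrite exprVn -invr_expz.
Qed.

End AbsoluteValue.

End LaurentDegree.

(** * The Riccati residual in characteristic 2 *)

Section Riccati.
Implicit Types (a b : laurent 'F_2) (p : {poly 'F_2}).

Lemma laddxx a : a + a = 0.
Proof. by apply/laurentP => i /=; apply: addrr_pchar2; exact: pchar_Fp. Qed.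

Lemma loppE a : - a = a.
Proof. by apply/eqP; rewrite eq_sym -addr_eq0 laddxx. Qed.

Lemma F2_eq1 (c : 'F_2) : c != 0 -> c = 1.
Proof. by case: c => [[|[|]]] // ? ?; apply/val_inj. Qed.

Lemma F2_sqr (c : 'F_2) : c ^+ 2 = c.
Proof. by have [->|/F2_eq1 ->] := eqVneq c 0; rewrite ?expr0n ?expr1n. Qed.

Lemma poly_F2_size2 p : size p = 2%N -> p = 'X + (p`_0)%:P.
Proof.
move=> sp; have p1 : p`_1 = 1.
  apply: F2_eq1; have := lead_coef_eq0 p.
  by rewrite lead_coefE -size_poly_eq0 sp => ->.
apply/polyP => -[|[|i]]; rewrite coefD coefX coefC ?add0r ?addr0 //=.
by rewrite nth_default ?sp.
Qed.

Definition ric a := lderiv a * lpoly ('X^2 + 'X) + a + a ^+ 2 + 1.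

Lemma ric_eq0 a :
  lderiv (a * (lvar 'F_2 * (lvar 'F_2 + 1))) = a ^+ 2 + 1 <-> ric a = 0.
Proof.
have -> : lvar 'F_2 * (lvar 'F_2 + 1) = lpoly ('X^2 + 'X).
  by rewrite -[1 : laurent _]/(lpoly 1) -rmorphD -rmorphM mulrDr mulr1 -expr2.
rewrite lderivM lderiv_lpoly derivD derivX derivXn expr1 mulr2n.
have -> : 'X + 'X + 1 = 1 :> {poly 'F_2}.
  by rewrite addrr_pchar2 ?add0r // pchar_poly pchar_Fp.
rewrite rmorph1 mulr1 /ric -addrA; split=> [->|/eqP]; first exact: laddxx.
by rewrite addr_eq0 loppE => /eqP.
Qed.

Lemma ric0 : ric 0 = 1.
Proof. by rewrite /ric lderiv0 mul0r expr0n !add0r. Qed.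

Lemma ricD a b : ric (a + b) = ric a + ric b + 1.
Proof.
rewrite /ric lderivD; set q := lpoly _.
(* The two sides differ by [2 * (a * b - 1)], from the cross term of the square and the surplus
   constants; [ring] has to be given that this vanishes. *)
have h := laddxx (a * b - 1).
rewrite -[LHS]addr0 -[0 in LHS]oppr0 -h; ring.
Qed.

(** For [p = 'X + c] everything but the constant 1 cancels in pairs, because [c ^+ 2 = c] in the
    field with two elements. *)
Lemma ric_lpoly p : size p = 2%N -> ric (lpoly p) = 1.
Proof.
move=> /poly_F2_size2 ->; move: (p`_0) => c.
rewrite /ric lderiv_lpoly derivD derivX derivC addr0 rmorph1 mul1r.
rewrite -[1 : laurent _]/(lpoly 1) -rmorphXn -!rmorphD; congr lpoly.
have h (x : {poly 'F_2}) : x + x = 0.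
  by apply: addrr_pchar2; rewrite pchar_poly pchar_Fp.
have c2 : c%:P ^+ 2 = c%:P :> {poly 'F_2} by rewrite -rmorphXn F2_sqr.
rewrite sqrrD c2 mulr2n h addr0 -[RHS]add0r -(h ('X^2 + 'X + c%:P)); ring.
Qed.

Lemma ricV a : a != 0 -> ric a^-1 = ric a / a ^+ 2.
Proof.
by move=> a0; rewrite /ric lderivV // loppE exprVn; exact: riccati_inversion.
Qed.

(** The value 1 of [ric (lpoly p)] cancels the extra 1 of [ricD]. *)
Lemma ric_step p b : size p = 2%N -> lpoly p + b != 0 ->
  ric (lpoly p + b)^-1 = ric b * (lpoly p + b)^-1 ^+ 2.
Proof.
move=> sp h; rewrite ricV // ricD ric_lpoly //.
by rewrite [1 + _]addrC -addrA laddxx addr0 exprVn.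
Qed.

(** Continuity of [ric] with the loss of one degree: differentiation lowers the degree by 1, and the
    factor ['X^2 + 'X] raises it by 2. *)
Lemma ricB_bound n a b : lbound (-1) a -> lbound (-1) b -> lbound n (a - b) ->
  lbound (n + 1) (ric a - ric b).
Proof.
move=> ha hb hab; have -> : ric a - ric b =
    lderiv (a - b) * lpoly ('X^2 + 'X) + (a - b) + (a - b) * (a + b).
  by rewrite [in lderiv _]loppE lderivD -[lderiv b]loppE /ric; ring.
apply: lboundD.
  apply: lboundD; last by apply: lboundW hab; lia.
  have -> : n + 1 = (n - 1) + 2 by lia.
  apply: lboundM; first exact: lbound_lderiv.
  apply: lboundW (@lbound_lpoly _ _).
  by rewrite size_polyDl size_polyXn // size_polyX.
by apply: lboundW (lboundM hab (lboundD ha hb)); lia.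
Qed.

(** * Finite continued fractions with linear partial quotients *)

Definition cfvalue (s : seq {poly 'F_2}) : laurent 'F_2 :=
  cfrac 0 [seq lpoly p | p <- s].

Lemma cfvalue_cons p s : cfvalue (p :: s) = (lpoly p + cfvalue s)^-1.
Proof.
by rewrite /cfvalue /= add0r; case: s => [|q s] /=; rewrite ?addr0 ?add0r.
Qed.

Lemma convergentE (q : nat -> {poly 'F_2}) n :
  q 0%N = 0 -> convergent q n = cfvalue [seq q i | i <- iota 1 n].
Proof. by rewrite /convergent /cfvalue -map_comp => ->; rewrite rmorph0. Qed.

Lemma has_ldeg_linear p b : size p = 2%N -> lbound (-1) b ->
  has_ldeg 1 (lpoly p + b).
Proof.
move=> /has_ldeg_lpoly hp hb; apply: has_ldegD => //.
by apply: lboundW hb.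
Qed.

Lemma lbound_cfvalue s : all (fun p => size p == 2%N) s -> lbound (-1) (cfvalue s).
Proof.
elim: s => [//|p s IH] /andP[/eqP sp /IH hs]; rewrite cfvalue_cons.
by have [] := has_ldegV (has_ldeg_linear sp hs).
Qed.

(** Starting from [ric 0 = 1], each quotient multiplies the residual by the square of a series of
    degree -1; the gain of two degrees is rounded down to one. *)
Lemma lbound_ric_cfvalue s : all (fun p => size p == 2%N) s ->
  lbound (- (size s)%:Z) (ric (cfvalue s)).
Proof.
elim: s => [_|p s IH].
  by rewrite /cfvalue ric0; case: (has_ldeg1 'F_2).
move=> /andP[/eqP sp hs]; have hp := has_ldeg_linear sp (lbound_cfvalue hs).
rewrite cfvalue_cons ric_step ?(has_ldeg_neq0 hp) //.
have [_ hV] := has_ldegV hp; rewrite expr2.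
by apply: lboundW (lboundM (IH hs) (lboundM hV hV)) => /=; lia.
Qed.

(** * Expansion of a Riccati solution *)

Definition cfquo a : {poly 'F_2} := 'X + (a^-1 0)%:P.
(** [cfquo a] is linear for every [a]; when [a^-1] has degree 1 it is the polynomial part of [a^-1],
    and [cfnext a] is then the fractional part. *)
Definition cfnext a : laurent 'F_2 := a^-1 - lpoly (cfquo a).

Lemma size_cfquo a : size (cfquo a) = 2%N.
Proof. exact: size_XaddC. Qed.

Lemma cfnextK a : a = (lpoly (cfquo a) + cfnext a)^-1.
Proof. by rewrite /cfnext addrC subrK invrK. Qed.

Definition ric_sol a := lbound (-1) a /\ ric a = 0.

Lemma ric_sol_neq0 a : ric_sol a -> a != 0.
Proof.
by move=> [_]; apply: contra_eq_neq => ->; rewrite ric0 oner_eq0.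
Qed.

(* If deg(1/a) = d >= 2, then the term 1/a^2 of degree 2d cannot cancel in the
   Riccati equation of 1/a, whose other terms have degree at most d + 1. *)
Lemma ric_sol_ldegV a : ric_sol a -> has_ldeg 1 a^-1.
Proof.
move=> sa; have a0 := ric_sol_neq0 sa; have [ha ra] := sa.
have [n dn] : exists n, has_ldeg n a by exact: ldeg_exists.
have n_lt0 : n <= -1.
  by rewrite leNgt; apply/negP => /ha an; case: dn; rewrite an eqxx.
have dV := has_ldegV dn.
suff <- : - n = 1 by [].
apply/eqP; rewrite eq_le; apply/andP; split; last by lia.
rewrite leNgt; apply/negP => n_gt1.
have : ric a^-1 = 0 by rewrite ricV // ra mul0r.
have -> : ric a^-1 =
    a^-1 * a^-1 + (lderiv a^-1 * lpoly ('X^2 + 'X) + a^-1 + 1).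
  by rewrite /ric; ring.
apply/eqP/(@has_ldeg_neq0 _ (- n + - n)).
apply: has_ldegD; first exact: has_ldegM.
have [_ hV] := dV.
apply: lboundD; last by apply: lboundW (has_ldeg1 _).2; lia.
apply: lboundD; last by apply: lboundW hV; lia.
apply: lboundW (lboundM (lbound_lderiv hV) (@lbound_lpoly _ _)).
by rewrite size_polyDl size_polyXn ?size_polyX //; lia.
Qed.

Lemma ric_sol_next a : ric_sol a -> ric_sol (cfnext a).
Proof.
move=> sa; have [bn hb] := ric_sol_ldegV sa; split.
  (* The coefficient of exponent 0 cancels by the choice of [cfquo], that of exponent 1 because a
     nonzero element of the field is 1. *)
  move=> [[|[|i]]|i] //= _; rewrite coefD coefX coefC /= ?add0r ?addr0 ?subrr //.
    by rewrite (F2_eq1 bn) subrr.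
  by rewrite hb ?subrr.
have a0 := ric_sol_neq0 sa; have [_ ra] := sa.
rewrite /cfnext loppE ricD ric_lpoly ?size_cfquo // ricV // ra mul0r add0r.
exact: laddxx.
Qed.

Definition cfquos a (i : nat) : {poly 'F_2} :=
  if i is k.+1 then cfquo (iter k cfnext a) else 0.

Lemma cfquos_next a n :
  [seq cfquos a i | i <- iota 1 n.+1] =
  cfquo a :: [seq cfquos (cfnext a) i | i <- iota 1 n].
Proof.
rewrite /=; congr (_ :: _); rewrite (iotaDl 1 1) -map_comp; apply/eq_in_map.
by move=> [|i]; rewrite mem_iota //= => _; rewrite -iterSr.
Qed.

Lemma all_cfquos a n :
  all (fun p => size p == 2%N) [seq cfquos a i | i <- iota 1 n].
Proof.
apply/allP => _ /mapP[[|i] + ->]; rewrite mem_iota //= => _.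
by rewrite size_cfquo.
Qed.

(** Inverting two series of degree 1 divides their difference by a product of degree 2, so each
    further quotient improves the approximation by at least one degree. *)
Lemma cfquos_approx a n : ric_sol a ->
  lbound (- n%:Z) (a - cfvalue [seq cfquos a i | i <- iota 1 n]).
Proof.
elim: n a => [|n IH] a sa.
  by rewrite -[cfvalue _]/(0 : laurent 'F_2) subr0; apply: lboundW sa.1.
have sb := ric_sol_next sa.
rewrite cfquos_next cfvalue_cons {1}(cfnextK a).
have := IH _ sb; have := lbound_cfvalue (all_cfquos (cfnext a) n).
move: (cfvalue _) => c hc hbc.
have d1 := has_ldeg_linear (size_cfquo a) sb.1.
have d2 := has_ldeg_linear (size_cfquo a) hc.
have x0 := has_ldeg_neq0 d1; have y0 := has_ldeg_neq0 d2.
have [_ h1] := has_ldegV d1; have [_ h2] := has_ldegV d2.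
set x := lpoly _ + _ in x0 h1 *; set y := lpoly _ + c in y0 h2 *.
have -> : x^-1 - y^-1 = - (cfnext a - c) * (x^-1 * y^-1).
  have -> : cfnext a - c = x - y by rewrite /x /y; ring.
  exact: subV_eq.
by apply: lboundW (lboundM (lboundN hbc) (lboundM h1 h2)); lia.
Qed.

(* Euclid's descent: passing to the complete quotient strictly decreases the
   degree of the denominator. *)
Lemma ric_sol_irrational a : ric_sol a -> ~ rational a.
Proof.
move=> sa [p [q [q0 ea]]]; have [n] := ubnP (size q).
elim: n => // n IH in a p q sa q0 ea *; rewrite ltnS => sq.
have a0 := ric_sol_neq0 sa.
have p0 : p != 0 by apply: contra_neq a0 => p0; rewrite ea p0 rmorph0 mul0r.
have [lp0 lq0] : lpoly p != 0 /\ lpoly q != 0 by rewrite !lpoly_eq0.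
(* As [a] has negative degree, [p] has smaller degree than [q]; and [p] is the denominator of
   [cfnext a]. *)
have spq : (size p < size q)%N.
  rewrite -[ltnRHS]prednK ?size_poly_gt0 // ltnS; apply/leq_sizeP => j hj.
  have : lbound (-1 + ((size q)%:Z - 1)) (lpoly p).
    by rewrite -(divfK lq0 (lpoly p)) -ea; exact: lboundM sa.1 (@lbound_lpoly _ q).
  move=> /(_ (Posz j)); apply.
  by move: q0 hj; rewrite -size_poly_gt0; lia.
apply: (IH (cfnext a) (q - cfquo a * p) p (ric_sol_next sa) p0).
  rewrite rmorphB rmorphM /cfnext ea invf_div; set c := lpoly (cfquo _).
  exact: div_sub_eq.
exact: leq_trans sq.
Qed.

(* The residual [ric] is continuous, so that of [a] is the limit of those of the
   convergents. *)
Lemma Dset_ric_sol (R : realType) (T : R) a : 1 < T -> Dset T a -> ric_sol a.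
Proof.
move=> hT [_ [q [[_ cvg_q] q0 sq]]].
have all_q n : all (fun p : {poly 'F_2} => size p == 2%N) [seq q i | i <- iota 1 n].
  by apply/allP => _ /mapP[i + ->]; rewrite mem_iota => /andP[i1 _]; rewrite sq.
pose c n := cfvalue [seq q i | i <- iota 1 n].
have near_c n : exists N, forall k, (N <= k)%N -> lbound n (a - c k).
  have [N _ hN] := (labs_cvg0P hT _).1 cvg_q n.
  by exists N => k /hN; rewrite /mkset convergentE.
have hc k : lbound (-1) (c k) := lbound_cfvalue (all_q k).
have ha : lbound (-1) a.
  have [N /(_ N (leqnn N)) h] := near_c (-1).
  by rewrite -(subrK (c N) a); exact: lboundD.
(* The bound [n - 1] makes up for the degree lost in [ricB_bound]. *)
split=> //; apply: lbound_eq0 => n; have [N hN] := near_c (n - 1).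
(* [N] brings the convergent close to [a]; the summand [|n|] ensures [- k <= n], so that its
   residual is small as well. *)
pose k := (N + `|n|)%N; rewrite -(subrK (ric (c k)) (ric a)); apply: lboundD.
  by rewrite -(subrK 1 n); exact: ricB_bound (hN k (leq_addr _ _)).
apply: lboundW (lbound_ric_cfvalue (all_q k)).
by rewrite size_map size_iota /k; lia.
Qed.

End Riccati.

Unset Implicit Arguments.

Theorem theorem3 (R : realType) (T : R) (hT : 1 < T) :
  Dset T `<=` Pset T /\
  forall alpha : laurent 'F_2, Pset T alpha ->
    (Dset T alpha <->
     lderiv (alpha * (lvar 'F_2 * (lvar 'F_2 + 1))) = alpha ^+ 2 + 1).
Proof.
split=> [a /(Dset_ric_sol hT)[ha _]|a /(labs_lt1P hT) ha].
  exact/(labs_lt1P hT).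
rewrite ric_eq0; split=> [/(Dset_ric_sol hT)[]//|ra].
have sa : ric_sol a by [].
split; first exact: ric_sol_irrational.
exists (cfquos a); split=> //; last by case=> // i _; exact: size_cfquo.
split; first by case=> // i _; rewrite size_cfquo.
(* From index [|n|] on, the error bound [- k] of [cfquos_approx] is at most [n]. *)
apply/(labs_cvg0P hT) => n; exists `|n|%N => // k hk.
rewrite /mkset convergentE //; apply: lboundW (@cfquos_approx a k sa).
by move: hk => /=; lia.
Qed.
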